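(* Let $p\in(0,1)$ and let $f^+$ be a probability density on $\mathbb{R}_+=[0,\infty)$ such that $f^+\in\mathcal{S}$ and $f^+\notin\mathcal{D}$. Then there exists a probability density $f^-$ on $\mathbb{R}_-=\mathbb{R}\setminus\mathbb{R}_+$ such that the density $f=pf^++(1-p)f^-$ on $\mathbb{R}$ satisfies $f\notin\mathcal{S}$.
   Context: For non-negative functions, $\alpha(x)\sim\beta(x)$ means $\lim_{x\to\infty}\alpha(x)/\beta(x)=1$. For probability densities $f,g$ on $\mathbb{R}$, $f*g(x)=\int_{-\infty}^{\infty}f(x-y)g(y)\,dy$ and $f^{*2}=f*f$. A density on $\mathbb{R}_+$ (resp. $\mathbb{R}_-$) is regarded as a density on $\mathbb{R}$ vanishing off $\mathbb{R}_+$ (resp. $\mathbb{R}_-$). A non-negative measurable function $f$ on $\mathbb{R}$ is long-tailed, $f\in\mathcal{L}$, if $\lim_{x\to\infty}f(x-y)/f(x)=1$ for every $y\in\mathbb{R}$. A probability density $f$ is subexponential, $f\in\mathcal{S}$, if $f\in\mathcal{L}$ and $f^{*2}(x)\sim 2f(x)$ as $x\to\infty$. A function $\alpha:\mathbb{R}\to[0,\infty)$ is almost decreasing, $\alpha\in\mathcal{D}$, if there exist $x_0>0$ and $K>0$ such that $\alpha(x+y)\le K\alpha(x)$ for all $x>x_0$ and $y>0$. *)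

(* Defs.v *)
From HB Require Import structures.
From mathcomp Require Import all_boot all_order all_algebra.
From mathcomp Require Import all_classical all_reals all_analysis.

Set Implicit Arguments.
Unset Strict Implicit.
Unset Printing Implicit Defensive.

Import Order.TTheory GRing.Theory Num.Theory.
Import numFieldNormedType.Exports.

Local Open Scope classical_set_scope.
Local Open Scope ring_scope.

Definition prob_density (R : realType) (f : R -> R) : Prop :=
  [/\ measurable_fun setT f, forall x, 0 <= f x &
      (\int[@lebesgue_measure R]_x (f x)%:E = 1)%E].

Definition prob_density_on (R : realType) (D : set R) (f : R -> R) : Prop :=
  prob_density f /\ forall x, ~ D x -> f x = 0.

(* The convolution of two densities may be infinite at some points, so it takes
   extended real values. *)
Definition convolution (R : realType) (f g : R -> R) (x : R) : \bar R :=
  (\int[@lebesgue_measure R]_y (f (x - y) * g y)%:E)%E.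

(* Since 1 / 0 = +oo in \bar R, the ratio is 0 or +oo where a nonnegative a
   is divided by b x = 0; the limit 1 thus forces b x != 0 for all large x. *)
Definition asymp_equiv (R : realType) (a b : R -> \bar R) : Prop :=
  (a x / b x)%E @[x --> +oo%R] --> 1%E.

(* Since 1 / 0 = 0 in R, the limit 1 forces f x != 0 for all large x. *)
Definition long_tailed (R : realType) (f : R -> R) : Prop :=
  [/\ measurable_fun setT f, forall x, 0 <= f x &
      forall y, f (x - y) / f x @[x --> +oo] --> (1 : R)].

Definition subexponential (R : realType) (f : R -> R) : Prop :=
  [/\ prob_density f, long_tailed f &
      asymp_equiv (convolution f f) (fun x => (2 * f x)%:E)].

Definition almost_decreasing (R : realType) (a : R -> R) : Prop :=
  (forall x, 0 <= a x) /\
  exists x0 K : R, [/\ 0 < x0, 0 < K &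
    forall x y, x0 < x -> 0 < y -> a (x + y) <= K * a x].

(* Main.v *)
From HB Require Import structures.
Require Import Defs.
From mathcomp Require Import all_boot all_order all_algebra.
From mathcomp Require Import all_classical all_reals all_analysis.
From mathcomp Require Import measurable_realfun ring lra.

Import Order.TTheory GRing.Theory Num.Theory.
Import numFieldNormedType.Exports.

Local Open Scope classical_set_scope.
Local Open Scope ring_scope.

(** Since [f-] lives on the negative half-line, [f = p f+] on the positive one,
and [f * f >= 2 p (1 - p) f- * f+] pointwise, where
[(f- * f+)(x)] is the integral of [f+(x + y) f-(- y)] over [y > 0].  If [f+] is
not almost decreasing, there are arbitrarily large [x] and positive [y] for
which [f+(x + y)] exceeds any prescribed multiple of [f+(x)].  Choose such pairs
[(x_n, y_n)] with [x_n > n] and [f+(x_n + y_n) > K_n f+(x_n)], and let [f-]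
have a piece of mass [2 ^ -(n + 1)] spread uniformly over the unit interval
[(- y_n - 1, - y_n)] ([exists_prob_density_ge]).  That piece makes [f * f] at
[x_n] see the values of [f+] just above [x_n + y_n], and when [K_n] grows faster
than [2 ^ n] the ratio [(f * f)(x_n) / f(x_n)] is unbounded, so [f * f] is not
equivalent to [2 f].

A point value of [f+] says nothing about an integral unless [f+] varies slowly
near that point.  This is where long-tailedness enters: the integral of [f] over
a unit interval starting at [x] is eventually at least [f x / 2]
([long_tailed_window]).  The uniform convergence theorem for long-tailed
functions would give this, but only a lower bound is needed, and Fatou's lemma
provides it. *)

Lemma lebesgue_measure_shift (R : realType) (c : R) (A : set R) :
  measurable A ->
  pushforward lebesgue_measure (fun x => x + c : measurableTypeR R) A =
  lebesgue_measure A.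
Proof.
move=> mA; apply/esym/lebesgue_measure_unique => //=.
  exact: measurable_funD.
move=> mshift _ [[a b] _ <-] /=; rewrite /pushforward.
have -> : (fun x : R => x + c) @^-1` `]a, b] = `](a - c), (b - c)]%classic.
  by apply/seteqP; split => x /=; rewrite !in_itv /= ltrBlDr lerBrDr.
rewrite !lebesgue_measure_itv /= !lte_fin ltrD2r.
by case: ifP => // _; rewrite -!EFinB; congr _%:E; ring.
Qed.

Lemma ge0_integral_shift (R : realType) (c : R) (D : set R) (h : R -> \bar R) :
  measurable D -> measurable_fun D h -> (forall x, D x -> 0 <= h x)%E ->
  (\int[@lebesgue_measure R]_(x in D) h x =
   \int[@lebesgue_measure R]_(x in (fun x : R => (x + c)%R) @^-1` D) h (x + c)%R)%E.
Proof.
move=> mD mh h0.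
rewrite -(@ge0_integral_pushforward _ _ _ _ R
  (fun x : measurableTypeR R => x + c : measurableTypeR R)) //=.
- apply: eq_measure_integral => //=; first exact: measurable_funD.
  by move=> mshift A mA _; exact/esym/lebesgue_measure_shift.
- exact: measurable_funD.
- by move=> x; rewrite inE => /h0.
Qed.

(** Where [f x = 0] the ratio [f x / f x] is [0], which the limit [1] of that ratio
excludes for large [x]. *)
Lemma long_tailed_gt0 (R : realType) (f : R -> R) :
  long_tailed f -> \forall x \near +oo, 0 < f x.
Proof.
move=> [_ f0 ft]; have /cvgr_gt /(_ 0 ltr01) := ft 0.
apply: filterS => x; rewrite subr0 => fxx; rewrite lt_neqAle f0 andbT.
by apply: contraTneq fxx => <-; rewrite mul0r ltxx.
Qed.

(** If the bound failed at points [z_n] tending to infinity, the functions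
[s |-> f (z_n - s) / f (z_n)] would tend to [1] pointwise while their integrals
over an interval of length [1] stay below [1 / 2], against Fatou's lemma. *)
Lemma long_tailed_window (R : realType) (f : R -> R) :
  long_tailed f -> \forall x \near +oo,
  ((f x / 2)%:E <= \int[@lebesgue_measure R]_(s in `](-1)%R, 0%R[) (f (x - s))%:E)%E.
Proof.
move=> lf; have [mf f0 ft] := lf; apply: contrapT => bad.
have f_gt0 := @long_tailed_gt0 R f lf.
have /choice[z zP] (n : nat) : exists x : R, [/\ n%:R < x, 0 < f x &
    ((\int[@lebesgue_measure R]_(s in `](-1)%R, 0%R[) (f (x - s))%:E) < (f x / 2)%:E)%E].
  apply: contrapT => /forallNP none; apply: bad.
  near=> x; rewrite leNgt; apply/negP => lt_x; apply: (none x).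
  by split => //; near: x.
have zy : z n @[n --> \oo] --> +oo.
  apply/cvgryPge => A; near=> n.
  apply: le_trans (ltW (let: And3 a _ _ := zP n in a)).
  by near: n; exact: nbhs_infty_ger.
pose F n s := (f (z n - s) / f (z n))%:E.
have mF n : measurable_fun (`]-1, 0[%classic : set R) (F n).
  apply/measurable_EFinP; apply: measurable_funM => //.
  apply: (@measurableT_comp _ _ _ _ _ _ f) => //.
  exact: measurable_funB.
have F0 n (s : R) : `]-1, 0[%classic s -> (0 <= F n s)%E.
  by rewrite lee_fin divr_ge0.
have := @fatou _ _ R (@lebesgue_measure R) _ (measurable_itv `](-1)%R, 0%R[) F mF F0.
under eq_integral => s _.
  have : F n s @[n --> \oo] --> 1%E.
    apply/cvg_EFin; first exact: nearW.
    exact: (cvg_comp _ _ zy (ft s)).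
  move=> /cvg_limn_einf_sup[-> _]; over.
rewrite integral_cst //= lebesgue_measure_itv /= lte_fin oppr_lt0 ltr01.
rewrite opprK add0e mul1e leNgt => /negP; apply.
apply: (@le_lt_trans _ _ (2^-1)%:E); last by rewrite lte_fin; lra.
rewrite limn_einf_lim; apply: lime_le; first exact: is_cvg_einfs.
apply: nearW => n.
apply: (@le_trans _ _ (\int[lebesgue_measure]_(x in `](-1)%R, 0%R[) F n x)%E).
  by apply: ereal_inf_lbound; exists n => /=.
have [_ fz bz] := zP n.
have -> : (\int[lebesgue_measure]_(x in `](-1)%R, 0%R[) F n x =
  (f (z n))^-1%:E * \int[@lebesgue_measure R]_(s in `](-1)%R, 0%R[) (f (z n - s))%:E)%E.
  rewrite -ge0_integralZl_EFin //.
  - by apply: eq_integral => s _; rewrite /F mulrC EFinM.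
  - by move=> x _; rewrite lee_fin.
  - apply/measurable_EFinP; apply: (@measurableT_comp _ _ _ _ _ _ f) => //.
    exact: measurable_funB.
  - by rewrite invr_ge0.
have -> : (2^-1)%:E = ((f (z n))^-1%:E * (f (z n) / 2)%:E)%E.
  by rewrite -EFinM mulrA mulVf ?mul1r // gt_eqF.
by rewrite lee_pmul2l ?lte_fin ?invr_gt0 // ltW.
Unshelve. all: by end_near. Qed.

Lemma nneseries_half_powers (R : realType) :
  (\sum_(n <oo) ((2^-1 : R) ^+ n.+1)%:E = 1)%E.
Proof.
apply/cvg_lim => //.
have -> : (fun n => \sum_(0 <= i < n) ((2^-1 : R) ^+ i.+1)%:E)%E =
  EFin \o series (fun k => 1 / (2 ^ (k + 1))%:R : R^o).
  apply/funext => n /=; rewrite sumEFin; congr _%:E.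
  by apply: eq_bigr => i _; rewrite addn1 div1r natrX exprVn.
apply: cvg_comp; first exact: cvg_geometric_series_half.
by rewrite expr0 divr1.
Qed.

(** The density is the mixture of the uniform densities on the sets [A n] with
weights [2 ^ -(n + 1)].  The sets may overlap: the series of weighted indicators
is still bounded by the sum of the weights, which is [1]. *)
Lemma exists_prob_density_ge (R : realType) (D : set R) (A : nat -> set R) :
  (forall n, measurable (A n)) -> (forall n, A n `<=` D) ->
  (forall n, lebesgue_measure (A n) = 1%E) ->
  exists g : R -> R, prob_density_on D g /\
    forall n x, A n x -> 2^-1 ^+ n.+1 <= g x.
Proof.
move=> mA AD A1.
pose h n (x : R) : \bar R := ((2^-1 : R) ^+ n.+1 * \1_(A n) x)%:E.
pose G x : \bar R := (\sum_(n <oo) h n x)%E.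
have h0 n x : (0 <= h n x)%E by rewrite lee_fin mulr_ge0.
have G0 x : (0 <= G x)%E by apply: nneseries_ge0.
have mh n : measurable_fun setT (h n).
  by apply/measurable_EFinP; apply: measurable_funM => //; exact: measurable_indic.
have mG : measurable_fun setT G.
  have := @ge0_emeasurable_sum _ _ R setT h xpredT (fun k x _ _ => h0 k x)
    (fun k _ => mh k).
  by congr measurable_fun; apply/funext => x; apply: eq_eseriesl.
have G1 x : (G x <= 1)%E.
  rewrite -(nneseries_half_powers R); apply: lee_nneseries => [n _|n _].
    by [].
  by rewrite lee_fin ler_piMr // indicE lern1; case: (_ \in _).
have Gfin x : G x \is a fin_num.
  by rewrite ge0_fin_numE // (le_lt_trans (G1 x)) // ltry.
exists (fine \o G); split; [split; [split|]|].
- exact: (measurableT_comp (fine_measurable measurableT)).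
- by move=> x /=; exact: fine_ge0.
- under eq_integral => x _ do rewrite /= fineK //.
  rewrite integral_nneseries // -(nneseries_half_powers R).
  apply: eq_eseriesr => n _.
  under eq_integral => x _ do rewrite /h EFinM.
  rewrite ge0_integralZl_EFin //.
  + rewrite integral_indic; [|exact: measurableT|exact: mA].
    by rewrite setIT -[RHS]mule1; congr (_ * _)%E; exact: A1.
  + have mi : measurable_fun setT (fun x : R => (\1_(A n) x : R)%:E).
      by apply/measurable_EFinP; exact: measurable_indic.
    exact: mi.
- move=> x Dx /=; rewrite [G x]eseries0 // => n _ _.
  by rewrite /h indicE memNset ?mulr0 // => /AD.
- move=> n x Ax; rewrite -lee_fin fineK //.
  have -> : ((2^-1 : R) ^+ n.+1)%:E = h n x.
    by rewrite /h indicE mem_set // mulr1.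
  rewrite /G (@nneseriesD1 _ _ n xpredT) // leeDl //.
  exact: nneseries_ge0.
Qed.

Lemma prob_density_mix (R : realType) (p : R) (f g : R -> R) :
  0 <= p <= 1 -> prob_density f -> prob_density g ->
  prob_density (fun x => p * f x + (1 - p) * g x).
Proof.
move=> /andP[p0 p1] [mf f0 f1] [mg g0 g1].
have q0 : 0 <= 1 - p by rewrite subr_ge0.
split.
- by apply: measurable_funD; apply: measurable_funM.
- by move=> x; rewrite addr_ge0 // mulr_ge0.
- under eq_integral => x _ do rewrite EFinD !EFinM.
  have mE (k : R) (h : R -> R) : measurable_fun setT h ->
      measurable_fun setT (fun x => (k%:E * (h x)%:E)%E).
    move=> mh; under eq_fun do rewrite -EFinM.
    by apply/measurable_EFinP; exact: measurable_funM.
  rewrite ge0_integralD //=.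
  + rewrite !ge0_integralZl_EFin //.
    all: try exact/measurable_EFinP.
    all: try by move=> x _; rewrite lee_fin.
    by rewrite f1 g1 !mule1 -EFinD addrC subrK.
  + by move=> x _; rewrite -EFinM lee_fin mulr_ge0.
  + exact: mE.
  + by move=> x _; rewrite -EFinM lee_fin mulr_ge0.
  + exact: mE.
Qed.

(** Keeping in the convolution only the contribution of [u] in [(y - 1, y)], the
factor [f u] is at least [w] and the factor [f (x - u)] is at least
[v * h (x - u)]; the substitution [u = s + y] moves the window to [(-1, 0)]. *)
Lemma convolution_ge_window (R : realType) (f h : R -> R) (v w x y : R) :
  measurable_fun setT f -> (forall u, 0 <= f u) ->
  measurable_fun setT h -> (forall u, 0 <= h u) ->
  0 <= v -> (forall u, v * h u <= f u) -> 0 <= w ->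
  (forall u, `](y - 1), y[%classic u -> w <= f u) ->
  ((v * w)%:E * \int[@lebesgue_measure R]_(s in `](-1)%R, 0%R[) (h (x - y - s))%:E <=
   convolution f f x)%E.
Proof.
move=> mf f0 mh h0 v0 hf w0 wf.
pose D : set R := `](y - 1), y[%classic.
have mD : measurable D by exact: measurable_itv.
have mh' : measurable_fun D (fun u : R => (h (x - u))%:E).
  apply/measurable_EFinP; apply: (@measurableT_comp _ _ _ _ _ _ h) => //.
  exact: measurable_funB.
have mf' : measurable_fun setT (fun u : R => (f (x - u) * f u)%:E).
  apply/measurable_EFinP; apply: measurable_funM => //.
  apply: (@measurableT_comp _ _ _ _ _ _ f) => //.
  exact: measurable_funB.
have -> : (\int[@lebesgue_measure R]_(s in `](-1)%R, 0%R[) (h (x - y - s))%:E =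
    \int[@lebesgue_measure R]_(u in D) (h (x - u))%:E)%E.
  rewrite [RHS](@ge0_integral_shift R y) //; last by move=> u _; rewrite lee_fin.
  rewrite (_ : (fun u : R => u + y) @^-1` D = `](-1), 0[%classic).
    by apply: eq_integral => s _; congr (h _)%:E; ring.
  by apply/seteqP; split => u; rewrite /D /= !in_itv /=; lra.
rewrite -ge0_integralZl_EFin //; last 2 first.
- by move=> u _; rewrite lee_fin.
- exact: mulr_ge0.
apply: (@le_trans _ _ (\int[@lebesgue_measure R]_(u in D) (f (x - u) * f u)%:E)%E).
  apply: ge0_le_integral => //.
  - by move=> u _; rewrite -EFinM lee_fin !mulr_ge0.
  - exact: measurable_funeM.
  - exact: measurable_funS mf'.
  - move=> u Du; rewrite -EFinM lee_fin mulrAC.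
    by apply: ler_pM => //; [exact: mulr_ge0|exact: wf].
apply: ge0_subset_integral => //.
by move=> u _; rewrite lee_fin mulr_ge0.
Qed.

Theorem lemma2p3 (R : realType) (p : R) (hp0 : 0 < p) (hp1 : p < 1)
    (fplus : R -> R)
    (hdens : prob_density_on `[0, +oo[%classic fplus)
    (hsub : subexponential fplus)
    (hnad : ~ almost_decreasing fplus) :
  exists fminus : R -> R,
    prob_density_on `]-oo, 0[%classic fminus /\
    let f := fun x : R => p * fplus x + (1 - p) * fminus x in
    prob_density f /\ ~ subexponential f.
Proof.
have [[mfp fp0 _] lfp _] := hsub.
have [M [_ winM]] := @long_tailed_window R _ lfp.
have [N [_ posN]] := @long_tailed_gt0 R _ lfp.
(* The factor 2 ^ (n + 2) compensates for the weight 2 ^ -(n + 1) of the n-th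
   piece and for the constant 1 / 2 of the window bound; n + 1 is what remains. *)
pose L n := Num.max (Num.max M N) n%:R.
have /choice[c cP] (n : nat) : exists c : R * R, [/\ L n < c.1, 0 < c.2 &
    2 ^+ n.+2 * n.+1%:R * fplus c.1 < fplus (c.1 + c.2)].
  apply: contrapT => /forallNP none; apply: hnad; split => //.
  exists (Num.max 1 (L n)), (2 ^+ n.+2 * n.+1%:R); split.
  - by rewrite lt_max ltr01.
  - by rewrite mulr_gt0 // exprn_gt0.
  - move=> x y; rewrite gt_max => /andP[_ Lx] y0; rewrite leNgt; apply/negP => lt_f.
    by apply: (none (x, y)).
pose A n : set R := `](- (c n).2 - 1), (- (c n).2)[%classic.
have [|||g [gD gA]] := @exists_prob_density_ge R `]-oo, 0[%classic A.
- by move=> n; exact: measurable_itv.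
- move=> n x; have [_ + _] := cP n.
  by rewrite /A /= !in_itv /= => + /andP[_ +]; lra.
- move=> n; rewrite /A lebesgue_measure_itv /= lte_fin ifT; last lra.
  by rewrite -EFinB; congr _%:E; ring.
exists g; split => //=; set f := fun x => _.
have [dg g0] := gD.
have df : prob_density f.
  by apply: prob_density_mix => //; [rewrite !ltW | case: hdens].
split => // -[_ _ sub].
have : \forall x \near +oo, (convolution f f x / (2 * f x)%:E < 2%:E)%E.
  by apply: (sub _ (@nbhs_open_ereal_lt R 1 (cst 2) _)); rewrite /cst; lra.
move=> [B [_ ltB]].
(* For this n, x_n > B, so the ratio at x_n is below 2; the lower bound on the
   convolution makes it at least (1 - p) (n + 1) / 2, hence the threshold
   4 / (1 - p). *)
pose n := (Num.truncn (Num.max B (4 / (1 - p)))).+1.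
have [Lc c2 fc] := cP n; move: Lc; rewrite !gt_max -andbA => /and3P[Mc Nc nc].
have /ltW : Num.max B (4 / (1 - p)) < n%:R by exact: truncnS_gt.
rewrite ge_max => /andP[Bn pn].
set x := (c n).1 in fc Mc Nc nc; set y := (c n).2 in c2 fc.
have x0 : 0 <= x by rewrite (le_trans _ (ltW nc)).
have fx0 : 0 < fplus x by exact: posN.
have fxE : f x = p * fplus x.
  by rewrite /f g0 ?mulr0 ?addr0 //= in_itv /=; apply/negP; rewrite -leNgt.
have := ltB x (le_lt_trans Bn nc); rewrite fxE.
have q0 : 0 < 1 - p by rewrite subr_gt0.
have [_ gge0 _] := dg.
have [mf fge0 _] := df.
apply/negP; rewrite -leNgt.
have w0 : 0 < (1 - p) * 2^-1 ^+ n.+1.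
  by apply: mulr_gt0 => //; apply: exprn_gt0; rewrite invr_gt0.
have le_conv : ((p * (1 - p) * n.+1%:R * fplus x)%:E <= convolution f f x)%E.
  apply: le_trans (@convolution_ge_window R f fplus p
    ((1 - p) * 2^-1 ^+ n.+1) x (- y) _ _ _ _ _ _ _ _) => //.
  - rewrite opprK; apply: le_trans (lee_wpmul2l _ (winM (x + y) _)).
    + rewrite -EFinM lee_fin.
      have -> : p * (1 - p) * n.+1%:R * fplus x =
          p * ((1 - p) * 2^-1 ^+ n.+1) * (2 ^+ n.+2 * n.+1%:R * fplus x / 2).
        rewrite exprVn !exprS; field.
        by rewrite expf_neq0.
      rewrite ler_pM2l; last exact: mulr_gt0.
      by rewrite ler_pM2r // ltW.
    + by rewrite lee_fin ltW // mulr_gt0.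
    + by rewrite (lt_trans Mc) // ltrDl.
  - exact: ltW.
  - by move=> u; rewrite /f lerDl mulr_ge0 // ltW.
  - exact: ltW.
  - move=> u Au; rewrite /f; apply: (@le_trans _ _ ((1 - p) * g u)).
      by rewrite ler_pM2l //; exact: gA Au.
    by rewrite lerDr mulr_ge0 // ltW.
have fx2 : 0 < 2 * (p * fplus x) by rewrite !mulr_gt0.
rewrite inver gt_eqF // lee_pdivlMr //; apply: le_trans le_conv.
rewrite -EFinM lee_fin.
have : 4 <= (1 - p) * n.+1%:R.
  by rewrite mulrC -ler_pdivrMr // (le_trans pn) // ler_nat.
have pf : 0 < p * fplus x by exact: mulr_gt0.
move=> /(ler_wpM2l (ltW pf)); congr (_ <= _); ring.
Qed.
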